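(* Let $L(V)$ be the Kantor Lie-double of the Virasoro-like algebra, and let $\Delta_{\overline 1}(L(V))$ be the space of odd $\frac12$-superderivations of $L(V)$. Then $\Delta_{\overline 1}(L(V))=\{0\}$.
   Context: For $\mathbf{m}=(m_1,m_2),\mathbf{n}=(n_1,n_2)\in\mathbb{Z}^2$ write $\det\binom{\mathbf{n}}{\mathbf{m}}=n_1m_2-n_2m_1$. The Kantor Lie-double $L(V)=L(V)_{\overline 0}\oplus L(V)_{\overline 1}$ of the Virasoro-like algebra is the complex Lie superalgebra whose even part $L(V)_{\overline 0}$ has basis $\{L_{\mathbf{m}}\mid\mathbf{m}\in\mathbb{Z}^2\setminus\{\mathbf{0}\}\}$, whose odd part $L(V)_{\overline 1}$ has basis $\{G_{\mathbf{m}}\mid\mathbf{m}\in\mathbb{Z}^2\setminus\{\mathbf{0}\}\}$, and whose bracket is $[L_{\mathbf{m}},L_{\mathbf{n}}]=\det\binom{\mathbf{n}}{\mathbf{m}}L_{\mathbf{m}+\mathbf{n}}$, $[L_{\mathbf{m}},G_{\mathbf{n}}]=\det\binom{\mathbf{n}}{\mathbf{m}}G_{\mathbf{m}+\mathbf{n}}=[G_{\mathbf{m}},L_{\mathbf{n}}]$, $[G_{\mathbf{m}},G_{\mathbf{n}}]=L_{\mathbf{m}+\mathbf{n}}$, with the convention $L_{\mathbf{0}}=0$, $G_{\mathbf{0}}=0$. For $\delta\in\mathbb{C}$, a $\delta$-superderivation of a Lie superalgebra $L$ is a homogeneous (with respect to the $\mathbb{Z}_2$-grading) linear map $D:L\to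 L$ of degree $|D|$ with $D([x,y])=\delta([D(x),y]+(-1)^{|D||x|}[x,D(y)])$ for all homogeneous $x,y\in L$. It is odd if $|D|=\overline 1$, i.e. $D(L_{\overline 0})\subseteq L_{\overline 1}$ and $D(L_{\overline 1})\subseteq L_{\overline 0}$. *)

(* Defs.v *)
From HB Require Import structures.
From mathcomp Require Import all_boot all_order all_algebra.
From mathcomp Require Import finmap.
From mathcomp.multinomials Require Import monalg.
From mathcomp Require Import boolp classical_sets functions reals.
From mathcomp Require Import complex.
From mathcomp Require Import ring.

Set Implicit Arguments.
Unset Strict Implicit.
Unset Printing Implicit Defensive.

Import Order.TTheory GRing.Theory Num.Theory.
Local Open Scope classical_set_scope.
Local Open Scope ring_scope.

(** The group Z/2Z of parities is [bool] with [(+)] (exclusive or): [false] is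
    the even parity and [true] the odd one.  The sign (-1)^{|x||y|} is thus
    [(-1) ^+ (a && b)]. *)

Record lieSuperAlgebra (F : numFieldType) := LieSuperAlgebra {
  lsa_sort :> lmodType F;
  homog : bool -> set lsa_sort;
  bracket : lsa_sort -> lsa_sort -> lsa_sort;
  homog0 : forall a, homog a 0;
  homog_linear : forall a c x y,
    homog a x -> homog a y -> homog a (c *: x + y);
  homog_decomp : forall x, exists x0 x1,
    [/\ homog false x0, homog true x1 & x = x0 + x1];
  homog_direct : forall x, homog false x -> homog true x -> x = 0;
  bracket_linearl : forall c x y z,
    bracket (c *: x + y) z = c *: bracket x z + bracket y z;
  bracket_linearr : forall c x y z,
    bracket z (c *: x + y) = c *: bracket z x + bracket z y;
  bracket_homog : forall a b x y,
    homog a x -> homog b y -> homog (a (+) b) (bracket x y);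
  bracket_skew : forall a b x y, homog a x -> homog b y ->
    bracket x y = - ((-1) ^+ (a && b) *: bracket y x);
  bracket_jacobi : forall a b x y z, homog a x -> homog b y ->
    bracket x (bracket y z) =
      bracket (bracket x y) z + (-1) ^+ (a && b) *: bracket y (bracket x z)
}.

Definition superderivations (F : numFieldType) (L : lieSuperAlgebra F)
    (delta : F) (p : bool) : set (L -> L) :=
  [set D | [/\ linear D,
    forall a x, homog a x -> homog (p (+) a) (D x) &
    forall a b x y, homog a x -> homog b y ->
      D (bracket x y) =
        delta *: (bracket (D x) y + (-1) ^+ (p && a) *: bracket x (D y))]].

Definition det2 (n m : int * int) : int := n.1 * m.2 - n.2 * m.1.

Definition nz2 : choiceType := {m : int * int | m != 0}.

(** The underlying space is free on the pairs (parity, nonzero vector of Z^2). *)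
Definition LV_space (F : numFieldType) : lmodType F :=
  {malg F[(bool * nz2)%type]}.

(** Locked because deciding the convertibility of two distinct [<< k >>] does
    not terminate in practice. *)
HB.lock Definition basis_elt (F : numFieldType) (a : bool) (m : int * int) :
    LV_space F :=
  if insub m is Some k then << ((a, k) : (bool * nz2)%type) >> else 0.

Section KantorDouble.
Variable F : numFieldType.

Local Notation LV_space := (LV_space F).
Local Notation basis_elt := (@basis_elt F).

Definition Lvec : int * int -> LV_space := basis_elt false.
Definition Gvec : int * int -> LV_space := basis_elt true.

Definition LV_basis_bracket (k l : bool * nz2) : LV_space :=
  let m := val k.2 in
  let n := val l.2 in
  match k.1, l.1 with
  | false, false => (det2 n m)%:~R *: Lvec (m + n)
  | false, true | true, false => (det2 n m)%:~R *: Gvec (m + n)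
  | true, true => Lvec (m + n)
  end.

Definition linear_extension (f : bool * nz2 -> LV_space) (x : LV_space) :
    LV_space :=
  \sum_(k <- msupp x) x@_k *: f k.

Definition LV_bracket (x y : LV_space) : LV_space :=
  linear_extension (fun k => linear_extension (LV_basis_bracket k) y) x.

Definition LV_homog (a : bool) : set LV_space :=
  [set x | forall k, k.1 != a -> x@_k = 0].

Lemma basis_eltE a (k : nz2) : basis_elt a (val k) = << (a, k) >>.
Proof. by rewrite unlock valK. Qed.

Lemma basis_elt0 a : basis_elt a 0 = 0.
Proof. by rewrite unlock insubF // eqxx. Qed.

Lemma linear_extensionE f x (d : {fset (bool * nz2)%type}) : (msupp x `<=` d)%fset ->
  linear_extension f x = \sum_(k <- d) x@_k *: f k.
Proof.
move=> xd; rewrite /linear_extension (big_fset_incl _ xd) //= => k _ kx.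
by rewrite mcoeff_outdom ?scale0r.
Qed.

Lemma linear_extension_linear f c x y :
  linear_extension f (c *: x + y) =
  c *: linear_extension f x + linear_extension f y.
Proof.
pose d := (msupp (c *: x + y) `|` (msupp x `|` msupp y))%fset.
rewrite !(@linear_extensionE _ _ d) ?fsubsetUl //; last 2 first.
- exact: fsubset_trans (fsubsetUr _ _) (fsubsetUr _ _).
- exact: fsubset_trans (fsubsetUl _ _) (fsubsetUr _ _).
rewrite scaler_sumr -big_split /=; apply: eq_bigr => k _.
by rewrite mcoeffD mcoeffZ scalerDl scalerA.
Qed.

Lemma linear_extensionU f a k :
  linear_extension f (basis_elt a (val k)) = f (a, k).
Proof.
rewrite basis_eltE.
rewrite /linear_extension msuppU oner_eq0 big_seq_fset1 mcoeffUU.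
by rewrite scale1r.
Qed.

Lemma linear_extension_funlin f g c x :
  linear_extension (fun k => c *: f k + g k) x =
  c *: linear_extension f x + linear_extension g x.
Proof.
rewrite /linear_extension scaler_sumr -big_split /=; apply: eq_bigr => k _.
by rewrite scalerDr !scalerA mulrC.
Qed.

Lemma LV_bracket_linearl c x y z :
  LV_bracket (c *: x + y) z = c *: LV_bracket x z + LV_bracket y z.
Proof. exact: linear_extension_linear. Qed.

Lemma LV_bracket_linearr c x y z :
  LV_bracket z (c *: x + y) = c *: LV_bracket z x + LV_bracket z y.
Proof.
rewrite /LV_bracket -linear_extension_funlin; congr linear_extension.
by apply/funext => k; rewrite linear_extension_linear.
Qed.

Lemma LV_bracketU a b k l :
  LV_bracket (basis_elt a (val k)) (basis_elt b (val l)) =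
  LV_basis_bracket (a, k) (b, l).
Proof. by rewrite /LV_bracket !linear_extensionU. Qed.

Lemma LV_bracket0l z : LV_bracket 0 z = 0.
Proof.
by have := LV_bracket_linearl (-1) 0 0 z; rewrite scaler0 addr0 scaleN1r addNr.
Qed.

Lemma LV_bracket0r z : LV_bracket z 0 = 0.
Proof.
by have := LV_bracket_linearr (-1) 0 0 z; rewrite scaler0 addr0 scaleN1r addNr.
Qed.

Lemma LV_bracketZl c x z : LV_bracket (c *: x) z = c *: LV_bracket x z.
Proof. by rewrite -[c *: x]addr0 LV_bracket_linearl LV_bracket0l addr0. Qed.

Lemma LV_bracketZr c x z : LV_bracket z (c *: x) = c *: LV_bracket z x.
Proof. by rewrite -[c *: x]addr0 LV_bracket_linearr LV_bracket0r addr0. Qed.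

Lemma bracket_LL m n : m != 0 -> n != 0 ->
  LV_bracket (Lvec m) (Lvec n) = (det2 n m)%:~R *: Lvec (m + n).
Proof.
move=> m0 n0; rewrite /Lvec -[m](SubK nz2 m0) -[n](SubK nz2 n0).
by rewrite LV_bracketU.
Qed.

Lemma bracket_LG m n : m != 0 -> n != 0 ->
  LV_bracket (Lvec m) (Gvec n) = (det2 n m)%:~R *: Gvec (m + n).
Proof.
move=> m0 n0; rewrite /Lvec /Gvec -[m](SubK nz2 m0) -[n](SubK nz2 n0).
by rewrite LV_bracketU.
Qed.

Lemma bracket_GL m n : m != 0 -> n != 0 ->
  LV_bracket (Gvec m) (Lvec n) = (det2 n m)%:~R *: Gvec (m + n).
Proof.
move=> m0 n0; rewrite /Lvec /Gvec -[m](SubK nz2 m0) -[n](SubK nz2 n0).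
by rewrite LV_bracketU.
Qed.

Lemma bracket_GG m n : m != 0 -> n != 0 ->
  LV_bracket (Gvec m) (Gvec n) = Lvec (m + n).
Proof.
move=> m0 n0; rewrite /Gvec -[m](SubK nz2 m0) -[n](SubK nz2 n0).
by rewrite LV_bracketU.
Qed.

Lemma LV_homog0 a : LV_homog a 0.
Proof. by move=> k _; rewrite mcoeff0. Qed.

Lemma LV_homog_linear a c x y :
  LV_homog a x -> LV_homog a y -> LV_homog a (c *: x + y).
Proof.
by move=> hx hy k ka; rewrite mcoeffD mcoeffZ hx // hy // mulr0 addr0.
Qed.

Lemma LV_homogZ a c x : LV_homog a x -> LV_homog a (c *: x).
Proof.
by move=> hx; rewrite -[c *: x]addr0; apply: LV_homog_linear => //; apply: LV_homog0.
Qed.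

Lemma LV_homogU a k : LV_homog a << (a, k) >>.
Proof. by move=> l /negbTE la; rewrite mcoeffU -pair_eqE /= eq_sym la. Qed.

Lemma LV_homog_basis a m : LV_homog a (basis_elt a m).
Proof.
rewrite unlock; case: insub => [k|]; first exact: LV_homogU.
exact: LV_homog0.
Qed.

Lemma LV_expand (x : LV_space) : x = \sum_(k <- msupp x) x@_k *: basis_elt k.1 (val k.2).
Proof.
rewrite {1}(monalgE x); apply: eq_bigr => -[a k] _.
rewrite basis_eltE; apply/malgP => l.
by rewrite mcoeffZ !mcoeffU; case: eqP; rewrite ?mulr1n ?mulr1 ?mulr0n ?mulr0.
Qed.

Lemma LV_ind (P : LV_space -> Prop) :
  P 0 -> (forall c x y, P x -> P y -> P (c *: x + y)) ->
  (forall a (k : nz2), P (basis_elt a (val k))) -> forall x, P x.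
Proof.
move=> P0 Plin PU x; rewrite (LV_expand x).
by elim/big_rec: _ => // k y _ Py; exact: Plin.
Qed.

Lemma LV_homog_ind a (P : LV_space -> Prop) :
  P 0 -> (forall c x y, P x -> P y -> P (c *: x + y)) ->
  (forall k : nz2, P (basis_elt a (val k))) -> forall x, LV_homog a x -> P x.
Proof.
move=> P0 Plin PU x hx; rewrite (LV_expand x).
elim/big_rec: _ => // -[b k] y _ Py.
have [->|ba] := eqVneq b a; first exact: Plin.
by rewrite hx // scale0r add0r.
Qed.

Lemma LV_homog_decomp x : exists x0 x1,
  [/\ LV_homog false x0, LV_homog true x1 & x = x0 + x1].
Proof.
elim/LV_ind: x => [|c x y [x0 [x1 [h0 h1 ->]]] [y0 [y1 [k0 k1 ->]]]|[] k].
- by exists 0, 0; rewrite addr0; split => //; apply: LV_homog0.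
- exists (c *: x0 + y0), (c *: x1 + y1).
  by split; [exact: LV_homog_linear|exact: LV_homog_linear|rewrite scalerDr addrACA].
- exists 0, (basis_elt true (val k)).
  by rewrite add0r; split => //; [exact: LV_homog0|exact: LV_homog_basis].
- exists (basis_elt false (val k)), 0.
  by rewrite addr0; split => //; [exact: LV_homog_basis|exact: LV_homog0].
Qed.

Lemma LV_homog_direct x : LV_homog false x -> LV_homog true x -> x = 0.
Proof.
move=> h0 h1; apply/malgP => -[[] k]; rewrite mcoeff0; first exact: h0.
exact: h1.
Qed.

Let coef (a b : bool) (m n : int * int) : F :=
  if a && b then 1 else (det2 n m)%:~R.

Let LV_basis_bracketE a b k l : LV_basis_bracket (a, k) (b, l) =
  coef a b (val k) (val l) *: basis_elt (a (+) b) (val k + val l).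
Proof. by case: a; case: b => //=; rewrite scale1r. Qed.

Let coefE a b m n : m != 0 -> n != 0 ->
  LV_bracket (basis_elt a m) (basis_elt b n) =
  coef a b m n *: basis_elt (a (+) b) (m + n).
Proof.
move=> m0 n0; rewrite -[m](SubK nz2 m0) -[n](SubK nz2 n0).
by rewrite LV_bracketU LV_basis_bracketE.
Qed.

Let coef_kill a b c m n k : n + k = 0 ->
  coef a (b (+) c) m (n + k) * coef b c n k = 0.
Proof.
move=> nk0; rewrite nk0; have -> : k = - n by apply/eqP; rewrite -addr_eq0 addrC nk0.
have d0 u : det2 (0 : int * int) u = 0 by rewrite /det2 /=; ring.
have dN u : det2 (- u) u = 0 by rewrite /det2 /=; ring.
by rewrite /coef d0 dN; case: a; case: b; case: c => /=; rewrite ?mulr0 ?mul0r.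
Qed.

Let coef_kill' a b c m n k : m + n = 0 ->
  coef (a (+) b) c (m + n) k * coef a b m n = 0.
Proof.
move=> mn0; rewrite mn0; have -> : n = - m by apply/eqP; rewrite -addr_eq0 addrC mn0.
have d0 u : det2 u (0 : int * int) = 0 by rewrite /det2 /=; ring.
have dN u : det2 (- u) u = 0 by rewrite /det2 /=; ring.
by rewrite /coef d0 dN; case: a; case: b; case: c => /=; rewrite ?mulr0 ?mul0r.
Qed.

Let nestr a b c m n k : m != 0 -> n != 0 -> k != 0 ->
  LV_bracket (basis_elt a m) (LV_bracket (basis_elt b n) (basis_elt c k)) =
  (coef a (b (+) c) m (n + k) * coef b c n k) *:
    basis_elt (a (+) (b (+) c)) (m + (n + k)).
Proof.
move=> m0 n0 k0; rewrite coefE // LV_bracketZr.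
have [nk0|nk0] := eqVneq (n + k) 0; last by rewrite coefE // scalerA mulrC.
by rewrite coef_kill // nk0 basis_elt0 LV_bracket0r scaler0 scale0r.
Qed.

Let nestl a b c m n k : m != 0 -> n != 0 -> k != 0 ->
  LV_bracket (LV_bracket (basis_elt a m) (basis_elt b n)) (basis_elt c k) =
  (coef (a (+) b) c (m + n) k * coef a b m n) *:
    basis_elt (a (+) (b (+) c)) (m + (n + k)).
Proof.
move=> m0 n0 k0; rewrite coefE // LV_bracketZl.
have [mn0|mn0] := eqVneq (m + n) 0.
  by rewrite coef_kill' // mn0 basis_elt0 LV_bracket0l scaler0 scale0r.
by rewrite coefE // scalerA mulrC addbA addrA.
Qed.

Lemma LV_bracket_homog a b x y :
  LV_homog a x -> LV_homog b y -> LV_homog (a (+) b) (LV_bracket x y).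
Proof.
move=> hx hy; elim/LV_homog_ind: hx => [|c x1 x2 h1 h2|k].
- by rewrite LV_bracket0l; apply: LV_homog0.
- by rewrite LV_bracket_linearl; apply: LV_homog_linear.
elim/LV_homog_ind: hy => [|c y1 y2 h1 h2|l].
- by rewrite LV_bracket0r; apply: LV_homog0.
- by rewrite LV_bracket_linearr; apply: LV_homog_linear.
rewrite LV_bracketU LV_basis_bracketE; apply: LV_homogZ; exact: LV_homog_basis.
Qed.

Lemma LV_bracket_skew a b x y : LV_homog a x -> LV_homog b y ->
  LV_bracket x y = - ((-1) ^+ (a && b) *: LV_bracket y x).
Proof.
move=> hx hy; elim/LV_homog_ind: hx => [|c x1 x2 h1 h2|k].
- by rewrite LV_bracket0l LV_bracket0r scaler0 oppr0.
- rewrite LV_bracket_linearl LV_bracket_linearr h1 h2.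
  by rewrite scalerDr opprD scalerN !scalerA mulrC.
elim/LV_homog_ind: hy => [|c y1 y2 h1 h2|l].
- by rewrite LV_bracket0l LV_bracket0r scaler0 oppr0.
- rewrite LV_bracket_linearl LV_bracket_linearr h1 h2.
  by rewrite scalerDr opprD scalerN !scalerA mulrC.
rewrite !LV_bracketU !LV_basis_bracketE (addbC b) (addrC (val l)) scalerA -scaleNr.
congr (_ *: _); rewrite /coef /det2 /= andbC.
by case: a; case: b => /=; ring.
Qed.

Lemma LV_bracket_jacobi a b x y z : LV_homog a x -> LV_homog b y ->
  LV_bracket x (LV_bracket y z) =
    LV_bracket (LV_bracket x y) z +
    (-1) ^+ (a && b) *: LV_bracket y (LV_bracket x z).
Proof.
have comb (c s : F) (u1 u2 v1 v2 : LV_space) :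
  c *: (u1 + s *: v1) + (u2 + s *: v2) =
  (c *: u1 + u2) + s *: (c *: v1 + v2).
  by rewrite !scalerDr !scalerA [s * c]mulrC addrACA.
move=> hx hy; elim/LV_homog_ind: hx => [|c x1 x2 h1 h2|k].
- by rewrite !(LV_bracket0l, LV_bracket0r) scaler0 addr0.
- by rewrite !(LV_bracket_linearl, LV_bracket_linearr) h1 h2 comb.
elim/LV_homog_ind: hy => [|c y1 y2 h1 h2|l].
- by rewrite !(LV_bracket0l, LV_bracket0r) scaler0 addr0.
- by rewrite !(LV_bracket_linearl, LV_bracket_linearr) h1 h2 comb.
elim/LV_ind: z => [|c z1 z2 h1 h2|c j].
- by rewrite !LV_bracket0r scaler0 addr0.
- by rewrite !(LV_bracket_linearl, LV_bracket_linearr) h1 h2 comb.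
have nz (u : nz2) : val u != 0 := valP u.
rewrite nestl ?nestr ?nz //.
rewrite [b (+) (a (+) c)]addbCA [val l + (val k + val j)]addrCA scalerA -scalerDl.
congr (_ *: _); rewrite /coef /det2.
by case: a; case: b; case: c => /=; ring.
Qed.

Definition KantorDoubleVir : lieSuperAlgebra F :=
  LieSuperAlgebra LV_homog0 LV_homog_linear LV_homog_decomp LV_homog_direct
    LV_bracket_linearl LV_bracket_linearr LV_bracket_homog LV_bracket_skew
    LV_bracket_jacobi.

End KantorDouble.

(* Main.v *)
(** Write [D L_m = \sum_s a_s(m) G_(m+s)] and [D G_m = \sum_s b_s(m) L_(m+s)],
    and [<m, n> = det2 n m].  The derivation rule on the pairs (L, G) and (G, G)
    reads, whenever [m + n + s != 0],
      [2 <m, n> b_s(m+n) = a_s(m) + <m, n+s> b_s(n)]              (1)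
      [2 a_s(m+n) = <m+s, n> b_s(m) - <m, n+s> b_s(n)]            (2).
    Taking [n] parallel to [m] kills the left side of (1).  With [n = m] or
    [n = - m] this gives [a_s(m) = 0] when [<m, s> = 0]; when [<m, s> != 0] it
    gives [a_s(m) = - <m, s> b_s(k m)] for [k = 1, 2], whence [a_s(2m) = 2 a_s(m)],
    while (2) at [n = m] gives [a_s(2m) = a_s(m)].  So [a = 0], hence
    [b_s(m) = 0] if [<m, s> != 0], and (1) with [m] orthogonal to [n] removes the
    remaining values [b_s(n)]. *)

Require Import Defs.
From mathcomp Require Import all_boot all_order all_algebra.
From mathcomp Require Import boolp classical_sets functions reals.
From mathcomp Require Import complex.
From mathcomp.multinomials Require Import monalg.
From mathcomp Require Import ring zify.

Set Implicit Arguments.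
Unset Strict Implicit.
Unset Printing Implicit Defensive.

Import GRing.Theory Num.Theory.
Local Open Scope classical_set_scope.
Local Open Scope ring_scope.

(** * Parallel and transverse vectors in the lattice plane *)

Section PlaneDeterminant.
Implicit Types m n s : int * int.

Definition orth n : int * int := (- n.2, n.1).

Lemma pair_neq0 n : (n != 0) = (n.1 != 0) || (n.2 != 0).
Proof. by case: n => n1 n2; rewrite -negb_and. Qed.

Lemma det2nn n : det2 n n = 0.
Proof. by rewrite /det2 mulrC subrr. Qed.

Lemma det2nN n : det2 (- n) n = 0.
Proof. by rewrite /det2 /=; ring. Qed.

Lemma det2Dl m n s : det2 (m + n) s = det2 m s + det2 n s.
Proof. by rewrite /det2 /=; ring. Qed.

Lemma det2Dr m n s : det2 s (m + n) = det2 s m + det2 s n.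
Proof. by rewrite /det2 /=; ring. Qed.

Lemma det2C m n : det2 m n = - det2 n m.
Proof. by rewrite /det2; ring. Qed.

(* [det2 s (orth n)] is the dot product of [s] and [n], and
   [(s . n)^2 + (det2 s n)^2 = |s|^2 |n|^2]. *)
Lemma det2_orth_neq0 n s : n != 0 -> s != 0 -> det2 s n = 0 ->
  det2 s (orth n) != 0.
Proof.
rewrite !pair_neq0 => n0 s0 sn; apply/eqP => so.
have : (s.1 ^+ 2 + s.2 ^+ 2) * (n.1 ^+ 2 + n.2 ^+ 2) = 0.
  transitivity (det2 s (orth n) ^+ 2 + det2 s n ^+ 2).
    by rewrite /det2 /=; ring.
  by rewrite so sn expr0n addr0.
move/eqP; rewrite mulf_eq0 !paddr_eq0 ?sqr_ge0 // !sqrf_eq0.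
by move: n0 s0; do 4 case: eqP.
Qed.

End PlaneDeterminant.

(** * Coordinates, and how brackets with basis elements act on them *)

Section Coefficients.
Variable F : numFieldType.
Implicit Types (m n k : int * int) (a b : bool) (x y : LV_space F).

(** The value 0 at [m = 0] mirrors L_0 = G_0 = 0 and lets indices range over all of Z^2. *)
Definition coord a m x : F :=
  if insub m is Some k then x@_((a, k) : (bool * nz2)%type) else 0.

Lemma coord_linear a m c x y :
  coord a m (c *: x + y) = c * coord a m x + coord a m y.
Proof.
rewrite /coord; case: insub => [k|]; first by rewrite mcoeffD mcoeffZ.
by rewrite mulr0 addr0.
Qed.

Lemma coord0 a m : coord a m 0 = 0.
Proof. by rewrite /coord; case: insub => [k|] //; rewrite mcoeff0. Qed.

Lemma coord_at0 a x : coord a 0 x = 0.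
Proof. by rewrite /coord insubF // eqxx. Qed.

Lemma coordZ a m c x : coord a m (c *: x) = c * coord a m x.
Proof. by rewrite -[c *: x]addr0 coord_linear coord0 addr0. Qed.

Lemma coordD a m x y : coord a m (x + y) = coord a m x + coord a m y.
Proof. by rewrite -[x in LHS]scale1r coord_linear mul1r. Qed.

Lemma coord_basis a b m n :
  coord a m (basis_elt F b n) = [&& a == b, m == n & m != 0]%:R.
Proof.
have [->|m0] := eqVneq m 0; first by rewrite coord_at0 !andbF.
have [->|n0] := eqVneq n 0.
  by rewrite basis_elt0 coord0 (negPf m0) !andbF.
rewrite -[n](SubK nz2 n0) -[m](SubK nz2 m0) /coord valK basis_eltE mcoeffU.
move: (Sub n n0 : nz2) (Sub m m0 : nz2) => {n0 m0} n' m'.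
by rewrite andbT (inj_eq val_inj) xpair_eqE [a == b]eq_sym [m' == n']eq_sym.
Qed.

Lemma coord_eq0 x : (forall a m, coord a m x = 0) -> x = 0.
Proof.
move=> h; apply/malgP => -[a k]; rewrite mcoeff0 -(h a (val k)) /coord.
by rewrite valK.
Qed.

Lemma coord_homog a b m x : LV_homog a x -> b != a -> coord b m x = 0.
Proof. by rewrite /coord => hx ba; case: insub => [k|] //; apply: hx. Qed.

Definition struct_const a b m n : F :=
  if a && b then 1 else (det2 n m)%:~R.

Lemma bracket_basis a b m n : m != 0 -> n != 0 ->
  LV_bracket (basis_elt F a m) (basis_elt F b n) =
  struct_const a b m n *: basis_elt F (a (+) b) (m + n).
Proof.
move=> m0 n0; case: a; case: b; rewrite /struct_const /= ?scale1r.
- exact: bracket_GG.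
- exact: bracket_GL.
- exact: bracket_LG.
- exact: bracket_LL.
Qed.

(** Bracketing with a basis element translates indices injectively, so a single coordinate of [x]
    contributes. The index [k + n = 0] is excluded: for two odd factors the constant is 1, while the
    coordinate at 0 vanishes. *)
Lemma coord_bracketr a b k n x : n != 0 -> k + n != 0 ->
  coord (a (+) b) (k + n) (LV_bracket x (basis_elt F b n)) =
  struct_const a b k n * coord a k x.
Proof.
move=> n0 kn0; elim/LV_ind: x => [|c x y hx hy|a' m].
- by rewrite LV_bracket0l !coord0 mulr0.
- by rewrite LV_bracket_linearl !coord_linear hx hy; ring.
rewrite bracket_basis ?(valP m) // coordZ !coord_basis kn0 andbT.
rewrite (inj_eq (@addIb b)) (inj_eq (addIr n)).
have [<-|_] := eqVneq a a'; last by rewrite !mulr0.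
by have [->|_] := eqVneq k (val m); rewrite ?(valP m) // !mulr0.
Qed.

Lemma coord_bracketl a b m k y : m != 0 -> m + k != 0 ->
  coord (a (+) b) (m + k) (LV_bracket (basis_elt F a m) y) =
  struct_const a b m k * coord b k y.
Proof.
move=> m0 mk0; elim/LV_ind: y => [|c x y hx hy|b' n].
- by rewrite LV_bracket0r !coord0 mulr0.
- by rewrite LV_bracket_linearr !coord_linear hx hy; ring.
rewrite bracket_basis ?(valP n) // coordZ !coord_basis mk0 andbT.
rewrite (inj_eq (@addbI a)) (inj_eq (addrI m)).
have [<-|_] := eqVneq b b'; last by rewrite !mulr0.
by have [->|_] := eqVneq k (val n); rewrite ?(valP n) // !mulr0.
Qed.

End Coefficients.

(** * Solving the recurrence for a fixed shift [s], with [u] for a_s and [v] for b_s *)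

Section Recurrence.
Variables (F : numFieldType) (s : int * int) (u v : int * int -> F).
Hypotheses (u0 : u 0 = 0) (v0 : v 0 = 0) (vNs : v (- s) = 0).
Hypothesis rel_LG : forall m n : int * int, m != 0 -> n != 0 -> m + n + s != 0 ->
  2 * (det2 n m)%:~R * v (m + n) = u m + (det2 (n + s) m)%:~R * v n.
Hypothesis rel_GG : forall m n : int * int, m != 0 -> n != 0 -> m + n + s != 0 ->
  2 * u (m + n) = (det2 n (m + s))%:~R * v m - (det2 (n + s) m)%:~R * v n.

Let two_neq0 : (2 : F) != 0.
Proof. by rewrite pnatr_eq0. Qed.

Let dbl_neq0 (m : int * int) : m != 0 -> m + m != 0.
Proof. by rewrite !pair_neq0 /= => /orP[] h; apply/orP; [left|right]; lia. Qed.

Let det2_neq0 (m n : int * int) : det2 m n != 0 -> m != 0.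
Proof.
by move=> h; apply: contraNneq h => ->; rewrite /det2 /= !mul0r subrr.
Qed.

Lemma rec_u0 m : u m = 0.
Proof.
have [-> //|m0] := eqVneq m 0.
have [sm|sm] := eqVneq (det2 s m) 0.
  (* The side condition [m + n + s != 0] dictates [n]: take [m] if [s = 0], and [- m] otherwise. *)
  have [s0|s0] := eqVneq s 0.
    have := rel_LG m0 m0; rewrite s0 !addr0 => /(_ (dbl_neq0 m0)).
    by rewrite !det2nn mulr0 !mul0r addr0.
  have := @rel_LG m (- m) m0; rewrite oppr_eq0 subrr add0r => /(_ m0 s0).
  by rewrite det2Dl sm det2nN addr0 v0 mulr0 !mul0r addr0.
have mm0 := dbl_neq0 m0.
have shift0 k : det2 k m = 0 -> k + s != 0.
  by move=> km; apply: (@det2_neq0 _ m); rewrite det2Dl km add0r.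
have e1 := rel_LG m0 m0 (shift0 _ _).
have e2 := rel_LG m0 mm0 (shift0 _ _).
have e3 := rel_LG mm0 mm0 (shift0 _ _).
have e4 := rel_GG m0 m0 (shift0 _ _).
move: e1 e2 e3 e4; rewrite ?(det2Dl, det2Dr) det2nn !addr0 ?add0r [det2 m s]det2C.
move: (det2 s m) => t; rewrite !(rmorphN, rmorphD, mulr0, mul0r, mulr0z) /=.
move=> /(_ erefl) e1 /(_ erefl) e2 /(_ erefl) e3 /(_ erefl) e4.
apply: (mulfI two_neq0); rewrite mulr0.
(* With [t = det2 s m], this is [4 e2 - 2 e1 - 2 e3 + e4]: the part [4 e2 - 2 e3] says u(2m) = 2
   u(m), and [e4 - 2 e1] says u(2m) = u(m). *)
transitivity (4 * (u m + t%:~R * v (m + m)) - 2 * (u m + t%:~R * v m)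
  - 2 * (u (m + m) + (t%:~R + t%:~R) * v (m + m))
  + (2 * u (m + m) - (- t%:~R * v m - t%:~R * v m))); first by ring.
by rewrite -e1 -e2 -e3 e4; ring.
Qed.

Lemma rec_v_transverse m : det2 s m != 0 -> v m = 0.
Proof.
move=> sm; have [-> //|m0] := eqVneq m 0.
have := @rel_LG m m m0 m0.
have -> : m + m + s != 0.
  by apply: (@det2_neq0 _ m); rewrite !det2Dl det2nn !add0r.
move=> /(_ isT) /esym/eqP; rewrite rec_u0 det2Dl det2nn mulr0 mul0r !add0r.
by rewrite mulf_eq0 intr_eq0 (negPf sm) => /eqP.
Qed.

Lemma rec_v0 n : v n = 0.
Proof.
have [-> //|n0] := eqVneq n 0.
have m0 : orth n != 0 by move: n0; rewrite !pair_neq0 /= oppr_eq0 orbC.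
have nm : det2 n (orth n) != 0 by rewrite det2_orth_neq0 // det2nn.
have [s0|s0] := eqVneq s 0.
  (* No vector is transverse to [s = 0]. Instead, with [u = 0], the determinants on both sides of
     [rel_LG] cancel. *)
  have dbl m k : det2 m k != 0 -> 2 * v (k + m) = v m.
    move=> mk; have kmN0 : k + m != 0.
      by apply: (@det2_neq0 _ k); rewrite det2Dl det2nn add0r.
    have k0 : k != 0 by apply: (@det2_neq0 _ m); rewrite det2C oppr_eq0.
    have := rel_LG k0 (det2_neq0 mk).
    rewrite s0 !addr0 rec_u0 add0r => /(_ kmN0) e.
    by apply: (@mulfI _ (det2 m k)%:~R); rewrite ?intr_eq0 // -e; ring.
  have mn : det2 (orth n) n != 0 by rewrite det2C oppr_eq0.
  have e1 := dbl _ _ nm.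
  have e2 := dbl _ _ mn.
  (* With p = [orth n], evaluating 2 v(2p + n) in two ways gives v(p + n) = v(p), whereas [e2] gives
     2 v(p + n) = v(p); hence [e5]. *)
  have e3 : 2 * v (orth n + (orth n + n)) = v (orth n + n).
    by apply: dbl; rewrite det2Dl det2nn add0r.
  have e4 : 2 * v (orth n + n + orth n) = v (orth n).
    by apply: dbl; rewrite det2Dr det2nn add0r.
  have e5 : v (orth n + n) = 0.
    rewrite addrC e3 in e4.
    rewrite [n + _]addrC -e4 in e2.
    by apply/eqP; rewrite -(addKr (v (orth n + n)) (v _)) -mulr2n -mulr_natl e2 addNr.
  by rewrite -e1 e5 mulr0.
have [sn|/rec_v_transverse //] := eqVneq (det2 s n) 0.
(* Now [n] is parallel to [s]. At [n = - s] the coefficient of [v n] in [rel_LG] vanishes, so [vNs]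
   settles this case. *)
have [/eqP|ns] := eqVneq (n + s) 0; first by rewrite addr_eq0 => /eqP ->.
have so := det2_orth_neq0 n0 s0 sn.
have nso : det2 (n + s) (orth n) != 0.
  by rewrite det2_orth_neq0 // det2Dl det2nn add0r.
(* The sum [orth n + n] is transverse to [s], which kills the left side; [nso] says that the
   coefficient of [v n] is nonzero. *)
have := rel_LG m0 n0.
have -> : orth n + n + s != 0.
  apply: (@det2_neq0 _ s).
  by rewrite !det2Dl det2nn addr0 ![det2 _ s]det2C sn oppr0 addr0 oppr_eq0.
move=> /(_ isT); rewrite (@rec_v_transverse (orth n + n)); last first.
  by rewrite det2Dr sn addr0.
rewrite rec_u0 mulr0 add0r => /esym/eqP.
by rewrite mulf_eq0 intr_eq0 (negPf nso) => /eqP.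
Qed.

End Recurrence.

(** * From an odd half-superderivation to the recurrence *)

Section OddHalfSuperderivations.
Variables (F : numFieldType) (D : LV_space F -> LV_space F).
Hypothesis D_linear : linear D.
Hypothesis D_odd : forall a x, LV_homog a x -> LV_homog (~~ a) (D x).
Hypothesis D_bracket : forall a b x y, LV_homog a x -> LV_homog b y ->
  D (LV_bracket x y) =
  2^-1 *: (LV_bracket (D x) y + (-1) ^+ a *: LV_bracket x (D y)).

Let D0 : D 0 = 0.
Proof. by have := D_linear (-1) 0 0; rewrite !scaleN1r !addNr. Qed.

Let DZ c x : D (c *: x) = c *: D x.
Proof. by rewrite -[c *: x]addr0 D_linear D0 addr0. Qed.

(** The parity [false] gives a_s and [true] gives b_s. Both vanish at 0 and at [- s], by the
    conventions at index 0. *)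
Definition shift_coef (s : int * int) a (m : int * int) : F :=
  coord (~~ a) (m + s) (D (basis_elt F a m)).

(** Read the derivation rule at index [m + n + s]: only coefficients of shift [s] enter, so
    different shifts decouple. The factor 2 clears [2^-1]. *)
Lemma shift_coef_bracket s a b m n : m != 0 -> n != 0 -> m + n + s != 0 ->
  2 * struct_const F a b m n * shift_coef s (a (+) b) (m + n) =
  struct_const F (~~ a) b (m + s) n * shift_coef s a m +
  (-1) ^+ a * (struct_const F a (~~ b) m (n + s) * shift_coef s b n).
Proof.
move=> m0 n0 mns0.
have := D_bracket (@LV_homog_basis F a m) (@LV_homog_basis F b n).
move/(congr1 (fun x => 2 * coord (~~ (a (+) b)) (m + n + s) x)).
rewrite bracket_basis // DZ !coordZ mulrA coordD coordZ mulrA mulfV ?pnatr_eq0 //.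
rewrite mul1r => ->; congr (_ + _ * _).
  by rewrite -addNb addrAC coord_bracketr // addrAC.
by rewrite -addbN -addrA coord_bracketl // addrA.
Qed.

Lemma odd_half_superderivation_eq0 x : D x = 0.
Proof.
have D_basis a m : D (basis_elt F a m) = 0.
  apply: coord_eq0 => c k.
  have [->|ca] := eqVneq c (~~ a); last first.
    by apply: coord_homog ca; apply: D_odd; exact: LV_homog_basis.
  pose s := k - m; have -> : k = m + s by rewrite addrC subrK.
  rewrite -/(shift_coef s a m).
  have c0 b : shift_coef s b 0 = 0 by rewrite /shift_coef basis_elt0 D0 coord0.
  have cNs b : shift_coef s b (- s) = 0 by rewrite /shift_coef addNr coord_at0.
  have rel_LG m1 n : m1 != 0 -> n != 0 -> m1 + n + s != 0 ->
      2 * (det2 n m1)%:~R * shift_coef s true (m1 + n) =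
      shift_coef s false m1 + (det2 (n + s) m1)%:~R * shift_coef s true n.
    move=> m0 n0 mns; have := @shift_coef_bracket s false true m1 n m0 n0 mns.
    by rewrite /struct_const /= expr0 !mul1r.
  have rel_GG m1 n : m1 != 0 -> n != 0 -> m1 + n + s != 0 ->
      2 * shift_coef s false (m1 + n) =
      (det2 n (m1 + s))%:~R * shift_coef s true m1
      - (det2 (n + s) m1)%:~R * shift_coef s true n.
    move=> m0 n0 mns; have := @shift_coef_bracket s true true m1 n m0 n0 mns.
    by rewrite /struct_const /= expr1 mulr1 mulN1r.
  case: a.
    exact: (rec_v0 (c0 _) (c0 _) (cNs _) rel_LG rel_GG).
  exact: (rec_u0 (c0 _) (c0 _) rel_LG rel_GG).
elim/LV_ind: x => [//|c x y hx hy|a k]; last exact: D_basis.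
by rewrite D_linear hx hy scaler0 addr0.
Qed.

End OddHalfSuperderivations.

Theorem theorem4p2 (R : realType) :
  @superderivations R[i] (KantorDoubleVir R[i]) 2^-1 true = [set 0].
Proof.
apply/seteqP; split => D /=.
  case=> Dlin Dodd Dbr; apply/funext => x.
  (* Here [true (+) a] and [true && a] compute to [~~ a] and [a]. *)
  exact: (@odd_half_superderivation_eq0 _ D Dlin Dodd Dbr).
move=> ->; split => [c x y|a x _|a b x y _ _].
- by rewrite scaler0 addr0.
- exact: homog0.
- rewrite /GRing.zero /=.
  by rewrite /= LV_bracket0l LV_bracket0r !scaler0 addr0 scaler0.
Qed.
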